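(* Let $\mathcal{C}$ be a weakly Mal'tsev category with kernel pairs and equalisers. Then: (1) the forgetful functor $U_{2}\colon\mathsf{Cat}(\mathcal{C})\to \mathsf{MG}(\mathcal{C})$ is an isomorphism; (2) the forgetful functor $U_{3}\colon\mathsf{Grpd}(\mathcal{C}) \to\mathsf{Cat}(\mathcal{C})$ is an isomorphism if and only if every internal preorder in $\mathcal{C}$ is an equivalence relation.
   Context: A category $\mathcal{C}$ has kernel pairs if the pullback of any morphism along itself exists; it has split pullbacks if the pullback of a split epimorphism along a split epimorphism always exists. $\langle\cdot,\cdot\rangle$ denotes a morphism induced into a pullback. $\mathcal{C}$ is weakly Mal'tsev when it has split pullbacks and, for all $f\colon A\to B$, $r\colon B\to A$, $g\colon C\to B$, $s\colon B\to C$ with $fr=1_B=gs$, the pair of morphisms $e_1=\langle 1_A,sf\rangle\colon A\to A\times_BC$, $e_2=\langle rg,1_C\rangle\colon C\to A\times_BC$ into the pullback of $f$ and $g$ is jointly epimorphic. A reflexive graph in $\mathcal{C}$ consists of $d,c\colon C_1\to C_0$, $e\colon C_0\to C_1$ with $de=1_{C_0}=ce$. A multiplicative graph is a reflexive graph together with $m\colon C_2\to C_1$, where $C_2$ is the (chosen) pullback of $d$ and $c$, with projections $\pi_1,\pi_2$, $d\pi_1=c\pi_2$, such that $m\langle 1_{C_1},ed\rangle=1_{C_1}=m\langle ec,1_{C_1}\rangle$, $dm=d\pi_2$, $cm=c\pi_1$. An internal category is a multiplicative graph satisfying $m(1\times m)=m(m\times 1)$. An internal groupoid is an internal category for which there is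 $t\colon C_1\to C_1$ with $ct=d$, $dt=c$, $m\langle 1_{C_1},t\rangle=ec$, $m\langle t,1_{C_1}\rangle=ed$. $\mathsf{MG}(\mathcal{C})$, $\mathsf{Cat}(\mathcal{C})$ and $\mathsf{Grpd}(\mathcal{C})$ are the categories of multiplicative graphs, internal categories and internal groupoids (morphisms are pairs $(f_1,f_0)$ commuting with $d,c,e,m$). An internal preorder (reflexive and transitive relation) is an internal category (equivalently a multiplicative graph) in which $d,c$ are jointly monomorphic; it is an equivalence relation if it is an internal groupoid. *)

(* Defs.v *)
From Stdlib Require Import ProofIrrelevance.

Set Implicit Arguments.
Unset Strict Implicit.
Unset Printing Implicit Defensive.

Declare Scope cat_scope.
Delimit Scope cat_scope with cat.
Local Open Scope cat_scope.

Reserved Notation "g ∘ f" (at level 40, left associativity).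

Record category := Category {
  obj :> Type;
  hom : obj -> obj -> Type;
  idm : forall A, hom A A;
  comp : forall A B D, hom B D -> hom A B -> hom A D
    where "g ∘ f" := (comp g f);
  comp_idl : forall A B (f : hom A B), idm B ∘ f = f;
  comp_idr : forall A B (f : hom A B), f ∘ idm A = f;
  comp_assoc : forall A B D E (h : hom D E) (g : hom B D) (f : hom A B),
    h ∘ (g ∘ f) = (h ∘ g) ∘ f
}.

Arguments idm {c} A.
Notation "g ∘ f" := (comp g f) : cat_scope.

Record functor (C D : category) := Functor {
  fobj :> C -> D;
  fmap : forall A B : C, hom A B -> hom (fobj A) (fobj B);
  fmap_id : forall A : C, fmap (idm A) = idm (fobj A);
  fmap_comp : forall (A B E : C) (g : hom B E) (f : hom A B),
    fmap (g ∘ f) = fmap g ∘ fmap f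
}.

Arguments fmap {C D} F {A B} f : rename.

Definition functor_id (C : category) : functor C C :=
  @Functor C C (fun A => A) (fun A B f => f)
    (fun A => eq_refl) (fun A B E g f => eq_refl).

Lemma functor_comp_id (C D E : category) (G : functor D E) (F : functor C D)
  (A : C) : fmap G (fmap F (idm A)) = idm (G (F A)).
Proof. now rewrite !fmap_id. Qed.

Lemma functor_comp_comp (C D E : category) (G : functor D E) (F : functor C D)
  (A B X : C) (g : hom B X) (f : hom A B) :
  fmap G (fmap F (g ∘ f)) = fmap G (fmap F g) ∘ fmap G (fmap F f).
Proof. now rewrite !fmap_comp. Qed.

Definition functor_comp (C D E : category) (G : functor D E) (F : functor C D) :
  functor C E :=
  @Functor C E (fun A => G (F A)) (fun A B f => fmap G (fmap F f))
    (functor_comp_id G F) (functor_comp_comp G F).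

(* Isomorphism of categories (not merely an equivalence): there is a strict
   two-sided inverse functor. *)
Definition is_isomorphism (C D : category) (F : functor C D) : Prop :=
  exists G : functor D C,
    functor_comp G F = functor_id C /\ functor_comp F G = functor_id D.

Definition full_subcategory (C : category) (P : C -> Prop) : category :=
  @Category {A : C | P A}
    (fun A B => hom (proj1_sig A) (proj1_sig B))
    (fun A => idm (proj1_sig A))
    (fun A B D g f => g ∘ f)
    (fun A B f => comp_idl f)
    (fun A B f => comp_idr f)
    (fun A B D E h g f => comp_assoc h g f).

Definition full_inclusion (C : category) (P : C -> Prop) :
  functor (full_subcategory P) C :=
  @Functor (full_subcategory P) C (fun A => proj1_sig A) (fun A B f => f)
    (fun A => eq_refl) (fun A B E g f => eq_refl).

Record pullback (C : category) (A B D : C) (f : hom A B) (g : hom D B) :=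
  Pullback {
  pb_obj :> C;
  pb_fst : hom pb_obj A;
  pb_snd : hom pb_obj D;
  pb_comm : f ∘ pb_fst = g ∘ pb_snd;
  pb_pair : forall (T : C) (a : hom T A) (b : hom T D),
    f ∘ a = g ∘ b -> hom T pb_obj;
  pb_pair_fst : forall (T : C) (a : hom T A) (b : hom T D)
    (h : f ∘ a = g ∘ b), pb_fst ∘ pb_pair h = a;
  pb_pair_snd : forall (T : C) (a : hom T A) (b : hom T D)
    (h : f ∘ a = g ∘ b), pb_snd ∘ pb_pair h = b;
  pb_pair_unique : forall (T : C) (u v : hom T pb_obj),
    pb_fst ∘ u = pb_fst ∘ v -> pb_snd ∘ u = pb_snd ∘ v -> u = v
}.

Arguments pb_fst {C A B D f g} p.
Arguments pb_snd {C A B D f g} p.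
Arguments pb_pair {C A B D f g} p {T a b} h.

Definition has_kernel_pairs (C : category) : Prop :=
  forall (A B : C) (f : hom A B), inhabited (pullback f f).

Definition is_equaliser (C : category) (A B E : C) (f g : hom A B)
  (e : hom E A) : Prop :=
  f ∘ e = g ∘ e /\
  forall (T : C) (h : hom T A), f ∘ h = g ∘ h ->
    exists! u : hom T E, e ∘ u = h.

Definition has_equalisers (C : category) : Prop :=
  forall (A B : C) (f g : hom A B),
    exists (E : C) (e : hom E A), is_equaliser f g e.

Definition split_epi (C : category) (A B : C) (f : hom A B) : Prop :=
  exists s : hom B A, f ∘ s = idm B.

Lemma split_epi_intro (C : category) (A B : C) (f : hom A B) (s : hom B A) :
  f ∘ s = idm B -> split_epi f.
Proof. intro h; exists s; exact h. Qed.

(* A choice of pullbacks of split epimorphisms along split epimorphisms.  Only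
   the property of being split is used, so the chosen pullback does not depend
   on the sections. *)
Definition split_pullbacks (C : category) : Type :=
  forall (A B D : C) (f : hom A B) (g : hom D B),
    split_epi f -> split_epi g -> pullback f g.

Definition jointly_epi (C : category) (A B X : C) (u : hom A X) (v : hom B X) :
  Prop :=
  forall (T : C) (p q : hom X T), p ∘ u = q ∘ u -> p ∘ v = q ∘ v -> p = q.

Definition jointly_mono (C : category) (A B X : C) (u : hom X A) (v : hom X B) :
  Prop :=
  forall (T : C) (p q : hom T X), u ∘ p = u ∘ q -> v ∘ p = v ∘ q -> p = q.

Section Pairing.
Context (C : category) (A B D : C).
Context (f : hom A B) (r : hom B A) (g : hom D B) (s : hom B D).
Context (hr : f ∘ r = idm B) (hs : g ∘ s = idm B).

Lemma pair_left_comm : f ∘ idm A = g ∘ (s ∘ f).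
Proof. now rewrite comp_assoc, hs, comp_idl, comp_idr. Qed.

Lemma pair_right_comm : f ∘ (r ∘ g) = g ∘ idm D.
Proof. now rewrite comp_assoc, hr, comp_idl, comp_idr. Qed.

(* e1 = <1, s f> and e2 = <r g, 1> *)
Definition pair_left (p : pullback f g) : hom A p := pb_pair p pair_left_comm.
Definition pair_right (p : pullback f g) : hom D p := pb_pair p pair_right_comm.
End Pairing.

Arguments pair_left {C A B D f g s} hs p.
Arguments pair_right {C A B D f r g} hr p.

Definition weakly_maltsev (C : category) (P : split_pullbacks C) : Prop :=
  forall (A B D : C) (f : hom A B) (r : hom B A) (g : hom D B) (s : hom B D)
    (hr : f ∘ r = idm B) (hs : g ∘ s = idm B),
    let p := P A B D f g (split_epi_intro hr) (split_epi_intro hs) in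
    jointly_epi (pair_left hs p) (pair_right hr p).

Record reflexive_graph (C : category) := ReflexiveGraph {
  rg_C1 : C;
  rg_C0 : C;
  rg_d : hom rg_C1 rg_C0;
  rg_c : hom rg_C1 rg_C0;
  rg_e : hom rg_C0 rg_C1;
  rg_de : rg_d ∘ rg_e = idm rg_C0;
  rg_ce : rg_c ∘ rg_e = idm rg_C0
}.

Section Composable.
Context (C : category) (P : split_pullbacks C) (X : reflexive_graph C).

Definition rg_C2 : pullback (rg_d X) (rg_c X) :=
  P (split_epi_intro (rg_de X)) (split_epi_intro (rg_ce X)).

(* <1, e d> and <e c, 1> *)
Definition rg_unit_right : hom (rg_C1 X) rg_C2 := pair_left (rg_ce X) rg_C2.
Definition rg_unit_left : hom (rg_C1 X) rg_C2 := pair_right (rg_de X) rg_C2.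

Lemma rg_pi1_unit : pb_fst rg_C2 ∘ rg_unit_right = idm (rg_C1 X).
Proof. apply pb_pair_fst. Qed.

Lemma rg_pi2_unit : pb_snd rg_C2 ∘ rg_unit_left = idm (rg_C1 X).
Proof. apply pb_pair_snd. Qed.

(* Composable triples ((x, y), (y, z)), as the pullback of the split
   epimorphisms pi2 and pi1. *)
Definition rg_C3 : pullback (pb_snd rg_C2) (pb_fst rg_C2) :=
  P (split_epi_intro rg_pi2_unit) (split_epi_intro rg_pi1_unit).
End Composable.

Record multiplicative_graph (C : category) (P : split_pullbacks C) :=
  MultiplicativeGraph {
  mg_graph :> reflexive_graph C;
  mg_m : hom (rg_C2 P mg_graph) (rg_C1 mg_graph);
  mg_unit_right : mg_m ∘ rg_unit_right P mg_graph = idm (rg_C1 mg_graph);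
  mg_unit_left : mg_m ∘ rg_unit_left P mg_graph = idm (rg_C1 mg_graph);
  mg_dm : rg_d mg_graph ∘ mg_m = rg_d mg_graph ∘ pb_snd (rg_C2 P mg_graph);
  mg_cm : rg_c mg_graph ∘ mg_m = rg_c mg_graph ∘ pb_fst (rg_C2 P mg_graph)
}.

Section Associativity.
Context (C : category) (P : split_pullbacks C) (X : multiplicative_graph P).

Lemma mg_one_times_m_comm :
  rg_d X ∘ (pb_fst (rg_C2 P X) ∘ pb_fst (rg_C3 P X)) =
  rg_c X ∘ (mg_m X ∘ pb_snd (rg_C3 P X)).
Proof.
now rewrite !comp_assoc, mg_cm, pb_comm, <- !comp_assoc, pb_comm.
Qed.

Lemma mg_m_times_one_comm :
  rg_d X ∘ (mg_m X ∘ pb_fst (rg_C3 P X)) =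
  rg_c X ∘ (pb_snd (rg_C2 P X) ∘ pb_snd (rg_C3 P X)).
Proof.
now rewrite !comp_assoc, mg_dm, <- pb_comm, <- !comp_assoc, pb_comm.
Qed.

(* On composable triples: (x, y, z) |-> (x, yz), resp. (xy, z). *)
Definition mg_one_times_m : hom (rg_C3 P X) (rg_C2 P X) :=
  pb_pair (rg_C2 P X) mg_one_times_m_comm.
Definition mg_m_times_one : hom (rg_C3 P X) (rg_C2 P X) :=
  pb_pair (rg_C2 P X) mg_m_times_one_comm.

Definition is_internal_category : Prop :=
  mg_m X ∘ mg_one_times_m = mg_m X ∘ mg_m_times_one.

Lemma mg_inv_right_comm (t : hom (rg_C1 X) (rg_C1 X)) :
  rg_c X ∘ t = rg_d X -> rg_d X ∘ idm (rg_C1 X) = rg_c X ∘ t.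
Proof. intro h; now rewrite h, comp_idr. Qed.

Lemma mg_inv_left_comm (t : hom (rg_C1 X) (rg_C1 X)) :
  rg_d X ∘ t = rg_c X -> rg_d X ∘ t = rg_c X ∘ idm (rg_C1 X).
Proof. intro h; now rewrite h, comp_idr. Qed.

Definition has_inverses : Prop :=
  exists (t : hom (rg_C1 X) (rg_C1 X))
    (hc : rg_c X ∘ t = rg_d X) (hd : rg_d X ∘ t = rg_c X),
    mg_m X ∘ pb_pair (rg_C2 P X) (mg_inv_right_comm hc) = rg_e X ∘ rg_c X /\
    mg_m X ∘ pb_pair (rg_C2 P X) (mg_inv_left_comm hd) = rg_e X ∘ rg_d X.
End Associativity.

Lemma mg_map2_comm (C : category) (P : split_pullbacks C)
  (X Y : reflexive_graph C)
  (f1 : hom (rg_C1 X) (rg_C1 Y)) (f0 : hom (rg_C0 X) (rg_C0 Y)) :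
  rg_d Y ∘ f1 = f0 ∘ rg_d X -> rg_c Y ∘ f1 = f0 ∘ rg_c X ->
  rg_d Y ∘ (f1 ∘ pb_fst (rg_C2 P X)) = rg_c Y ∘ (f1 ∘ pb_snd (rg_C2 P X)).
Proof.
intros hd hc.
now rewrite !comp_assoc, hd, hc, <- !comp_assoc, pb_comm.
Qed.

Record mg_hom (C : category) (P : split_pullbacks C)
  (X Y : multiplicative_graph P) := MGHom {
  mg_f1 : hom (rg_C1 X) (rg_C1 Y);
  mg_f0 : hom (rg_C0 X) (rg_C0 Y);
  mg_hom_d : rg_d Y ∘ mg_f1 = mg_f0 ∘ rg_d X;
  mg_hom_c : rg_c Y ∘ mg_f1 = mg_f0 ∘ rg_c X;
  mg_hom_e : mg_f1 ∘ rg_e X = rg_e Y ∘ mg_f0;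
  mg_hom_m : mg_f1 ∘ mg_m X =
    mg_m Y ∘ pb_pair (rg_C2 P Y) (mg_map2_comm P mg_hom_d mg_hom_c)
}.

Lemma mg_hom_ext (C : category) (P : split_pullbacks C)
  (X Y : multiplicative_graph P) (f g : mg_hom X Y) :
  mg_f1 f = mg_f1 g -> mg_f0 f = mg_f0 g -> f = g.
Proof.
destruct f as [f1 f0 fd fc fe fm], g as [g1 g0 gd gc ge gm]; simpl.
intros h1 h0; subst g1 g0.
pose proof (proof_irrelevance _ fd gd); subst gd.
pose proof (proof_irrelevance _ fc gc); subst gc.
f_equal; apply proof_irrelevance.
Qed.

Definition mg_id (C : category) (P : split_pullbacks C)
  (X : multiplicative_graph P) : mg_hom X X.
Proof.
unshelve refine (@MGHom C P X X (idm _) (idm _) _ _ _ _).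
- abstract (now rewrite comp_idl, comp_idr).
- abstract (now rewrite comp_idl, comp_idr).
- abstract (now rewrite comp_idl, comp_idr).
- abstract (rewrite comp_idl; transitivity (mg_m X ∘ idm _);
    [now rewrite comp_idr | f_equal];
    apply pb_pair_unique; rewrite ?pb_pair_fst, ?pb_pair_snd;
    now rewrite comp_idl, comp_idr).
Defined.

Definition mg_comp (C : category) (P : split_pullbacks C)
  (X Y Z : multiplicative_graph P) (g : mg_hom Y Z) (f : mg_hom X Y) :
  mg_hom X Z.
Proof.
unshelve refine (@MGHom C P X Z (mg_f1 g ∘ mg_f1 f) (mg_f0 g ∘ mg_f0 f)
  _ _ _ _).
- abstract (now rewrite comp_assoc, mg_hom_d, <- comp_assoc, mg_hom_d, comp_assoc).
- abstract (now rewrite comp_assoc, mg_hom_c, <- comp_assoc, mg_hom_c, comp_assoc).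
- abstract (now rewrite <- comp_assoc, mg_hom_e, comp_assoc, mg_hom_e, comp_assoc).
- abstract (rewrite <- comp_assoc, mg_hom_m, comp_assoc, mg_hom_m,
      <- comp_assoc; f_equal; apply pb_pair_unique;
    [ now rewrite comp_assoc, !pb_pair_fst, <- !comp_assoc, pb_pair_fst
    | now rewrite comp_assoc, !pb_pair_snd, <- !comp_assoc, pb_pair_snd ]).
Defined.

Definition MG (C : category) (P : split_pullbacks C) : category.
Proof.
refine (@Category (multiplicative_graph P) (@mg_hom C P) (@mg_id C P)
  (@mg_comp C P) _ _ _).
- abstract (intros; apply mg_hom_ext; apply comp_idl).
- abstract (intros; apply mg_hom_ext; apply comp_idr).
- abstract (intros; apply mg_hom_ext; apply comp_assoc).
Defined.

(* Associativity and the existence of inverses are properties of a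
   multiplicative graph, and the morphisms are the same in all cases. *)
Definition Cat (C : category) (P : split_pullbacks C) : category :=
  @full_subcategory (MG P) (@is_internal_category C P).

Definition Grpd (C : category) (P : split_pullbacks C) : category :=
  @full_subcategory (Cat P) (fun X => has_inverses (proj1_sig X)).

Definition U2 (C : category) (P : split_pullbacks C) : functor (Cat P) (MG P) :=
  @full_inclusion (MG P) (@is_internal_category C P).

Definition U3 (C : category) (P : split_pullbacks C) :
  functor (Grpd P) (Cat P) :=
  @full_inclusion (Cat P) (fun X => has_inverses (proj1_sig X)).

Definition is_internal_preorder (C : category) (P : split_pullbacks C)
  (X : Cat P) : Prop :=
  jointly_mono (rg_d (proj1_sig X)) (rg_c (proj1_sig X)).

Definition is_equivalence_relation (C : category) (P : split_pullbacks C)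
  (X : Cat P) : Prop :=
  is_internal_preorder X /\ has_inverses (proj1_sig X).

(* Main.v *)
(* Part (1): composable triples form a pullback of split epimorphisms, and the
   two ways of multiplying them agree on the triples (x, y, 1) and (1, y, z).

   Part (2): the weak Mal'tsev property makes every arrow of an internal
   category monic.  Indeed, if yz = yz', consider the tuples (y, z, z', w) with
   w and y of the same domain; wz = wz' holds when w = y and when z = z' = 1,
   hence always, in particular for w = 1.  It follows that the pairs (yz, y)
   form an internal preorder on the object of arrows, "being a right multiple".
   When it is symmetric, y is a right multiple of yz, so (taking y = 1) every
   arrow z has a right inverse, which is two-sided because z is monic. *)

From Stdlib Require Import ProofIrrelevance FunctionalExtensionality.
Require Import Defs.

Set Implicit Arguments.
Unset Strict Implicit.
Unset Printing Implicit Defensive.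

Local Open Scope cat_scope.

(** * Full subcategories whose inclusion is an isomorphism *)

(* Arrows are compared as dependent pairs, so that no transport along
   equalities of objects appears. *)
Lemma functor_full_subcategory_eq_id (C : category) (Q : C -> Prop)
  (F : functor (full_subcategory Q) (full_subcategory Q)) :
  (fun A => A) = fobj F ->
  (forall (A B : full_subcategory Q) (f : hom A B),
     existT (fun XY => hom (fst XY) (snd XY))
       (proj1_sig (F A), proj1_sig (F B)) (fmap F f) =
     existT (fun XY => hom (fst XY) (snd XY))
       (proj1_sig A, proj1_sig B) f) ->
  F = functor_id (full_subcategory Q).
Proof.
destruct F as [F0 F1 Fi Fc]; simpl; intros <- H.
assert (HF : F1 = fun A B f => f).
{ apply functional_extensionality_dep; intro A.
  apply functional_extensionality_dep; intro B.
  apply functional_extensionality_dep; intro f.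
  exact (inj_pair2 _ _ _ _ _ (H A B f)). }
subst F1; unfold functor_id; f_equal; apply proof_irrelevance.
Qed.

(** A strict inverse [G] exhibits each [A] as the underlying object of [G A], which carries a proof
    of [Q]. Conversely, proofs of [Q] are unique, so attaching one to each object is strictly
    inverse to forgetting it. *)
Lemma full_inclusion_is_isomorphism (C : category) (Q : C -> Prop) :
  is_isomorphism (full_inclusion Q) <-> forall A, Q A.
Proof.
split.
- intros [G [_ hG]] A.
  pose proof (f_equal (fun F : functor C C => fobj F A) hG) as h; simpl in h.
  rewrite <- h; exact (proj2_sig (G A)).
- intro hQ.
  exists (@Functor C (full_subcategory Q) (fun A => exist _ A (hQ A))
    (fun A B f => f) (fun A => eq_refl) (fun A B E g f => eq_refl)).
  split.
  + apply functor_full_subcategory_eq_id.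
    * apply functional_extensionality; intros [A hA]; simpl.
      f_equal; apply proof_irrelevance.
    * reflexivity.
  + unfold functor_comp, functor_id; simpl; f_equal; apply proof_irrelevance.
Qed.

(** * Multiplication of generalised elements, and associativity *)

Section Multiplication.
Context (C : category) (P : split_pullbacks C) (X : multiplicative_graph P).

Definition mul (T : C) (x y : hom T (rg_C1 X)) (h : rg_d X ∘ x = rg_c X ∘ y) :
  hom T (rg_C1 X) := mg_m X ∘ pb_pair (rg_C2 P X) h.

Lemma mul_congr (T : C) (x y x' y' : hom T (rg_C1 X))
  (h : rg_d X ∘ x = rg_c X ∘ y) (h' : rg_d X ∘ x' = rg_c X ∘ y') :
  x = x' -> y = y' -> mul h = mul h'.
Proof. intros -> ->; f_equal; apply proof_irrelevance. Qed.

Lemma mul_comp (T S : C) (x y : hom T (rg_C1 X)) (u : hom S T)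
  (x' y' : hom S (rg_C1 X))
  (h : rg_d X ∘ x = rg_c X ∘ y) (h' : rg_d X ∘ x' = rg_c X ∘ y') :
  x ∘ u = x' -> y ∘ u = y' -> mul h ∘ u = mul h'.
Proof.
intros <- <-; unfold mul; rewrite <- comp_assoc; f_equal.
apply pb_pair_unique; rewrite comp_assoc, ?pb_pair_fst, ?pb_pair_snd; reflexivity.
Qed.

Lemma d_mul (T : C) (x y : hom T (rg_C1 X)) (h : rg_d X ∘ x = rg_c X ∘ y) :
  rg_d X ∘ mul h = rg_d X ∘ y.
Proof. unfold mul; now rewrite comp_assoc, mg_dm, <- comp_assoc, pb_pair_snd. Qed.

Lemma c_mul (T : C) (x y : hom T (rg_C1 X)) (h : rg_d X ∘ x = rg_c X ∘ y) :
  rg_c X ∘ mul h = rg_c X ∘ x.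
Proof. unfold mul; now rewrite comp_assoc, mg_cm, <- comp_assoc, pb_pair_fst. Qed.

Lemma d_e (T : C) (a : hom T (rg_C0 X)) : rg_d X ∘ (rg_e X ∘ a) = a.
Proof. now rewrite comp_assoc, rg_de, comp_idl. Qed.

Lemma c_e (T : C) (a : hom T (rg_C0 X)) : rg_c X ∘ (rg_e X ∘ a) = a.
Proof. now rewrite comp_assoc, rg_ce, comp_idl. Qed.

(** The hypothesis forces [a] to be the domain of [x], so the pair being multiplied is the image of
    [x] under [rg_unit_right]. *)
Lemma mul_e_r (T : C) (x : hom T (rg_C1 X)) (a : hom T (rg_C0 X))
  (h : rg_d X ∘ x = rg_c X ∘ (rg_e X ∘ a)) : mul h = x.
Proof.
pose proof h as ha; rewrite c_e in ha.
transitivity (mg_m X ∘ rg_unit_right P X ∘ x).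
- unfold mul; rewrite <- comp_assoc; f_equal; apply pb_pair_unique;
    rewrite ?pb_pair_fst, ?pb_pair_snd, comp_assoc;
    unfold rg_unit_right, pair_left; rewrite ?pb_pair_fst, ?pb_pair_snd.
  + now rewrite comp_idl.
  + now rewrite <- comp_assoc, ha.
- now rewrite mg_unit_right, comp_idl.
Qed.

Lemma mul_e_l (T : C) (y : hom T (rg_C1 X)) (a : hom T (rg_C0 X))
  (h : rg_d X ∘ (rg_e X ∘ a) = rg_c X ∘ y) : mul h = y.
Proof.
pose proof h as ha; rewrite d_e in ha.
transitivity (mg_m X ∘ rg_unit_left P X ∘ y).
- unfold mul; rewrite <- comp_assoc; f_equal; apply pb_pair_unique;
    rewrite ?pb_pair_fst, ?pb_pair_snd, comp_assoc;
    unfold rg_unit_left, pair_right; rewrite ?pb_pair_fst, ?pb_pair_snd.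
  + now rewrite <- comp_assoc, ha.
  + now rewrite comp_idl.
- now rewrite mg_unit_left, comp_idl.
Qed.

Lemma m_eq_mul (T : C) (w : hom T (rg_C2 P X)) (x y : hom T (rg_C1 X))
  (h : rg_d X ∘ x = rg_c X ∘ y) :
  pb_fst (rg_C2 P X) ∘ w = x -> pb_snd (rg_C2 P X) ∘ w = y ->
  mg_m X ∘ w = mul h.
Proof.
intros hx hy; unfold mul; f_equal.
apply pb_pair_unique; now rewrite ?pb_pair_fst, ?pb_pair_snd.
Qed.

(** The elements x, y, z assemble into a T-point [w] of [rg_C3], at which the associativity equation
    is evaluated. *)
Lemma mul_assoc (hX : is_internal_category X) (T : C)
  (x y z : hom T (rg_C1 X))
  (hxy : rg_d X ∘ x = rg_c X ∘ y) (hyz : rg_d X ∘ y = rg_c X ∘ z)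
  (h1 : rg_d X ∘ x = rg_c X ∘ mul hyz) (h2 : rg_d X ∘ mul hxy = rg_c X ∘ z) :
  mul h1 = mul h2.
Proof.
assert (h : pb_snd (rg_C2 P X) ∘ pb_pair (rg_C2 P X) hxy
          = pb_fst (rg_C2 P X) ∘ pb_pair (rg_C2 P X) hyz)
  by now rewrite pb_pair_fst, pb_pair_snd.
set (w := pb_pair (rg_C3 P X) h).
transitivity (mg_m X ∘ (mg_one_times_m X ∘ w)).
- symmetry; apply m_eq_mul; unfold mg_one_times_m, w;
    rewrite comp_assoc, ?pb_pair_fst, ?pb_pair_snd, <- comp_assoc.
  + now rewrite !pb_pair_fst.
  + now rewrite !pb_pair_snd.
- rewrite comp_assoc, hX, <- comp_assoc.
  apply m_eq_mul; unfold mg_m_times_one, w;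
    rewrite comp_assoc, ?pb_pair_fst, ?pb_pair_snd, <- comp_assoc.
  + now rewrite !pb_pair_fst.
  + now rewrite !pb_pair_snd.
Qed.

Lemma weakly_maltsev_internal_category : weakly_maltsev P -> is_internal_category X.
Proof.
intro hWM; unfold is_internal_category.
apply (hWM _ _ _ _ _ _ _ (rg_pi2_unit P X) (rg_pi1_unit P X));
  fold (rg_C3 P X); rewrite <- !comp_assoc.
(* On triples (x, y, 1) both sides are xy: the pairs to multiply are (x, y1) = (x, y) and (xy,
   1). *)
- transitivity (mg_m X); [|symmetry].
  + transitivity (mg_m X ∘ idm _); [|apply comp_idr];
      f_equal; apply pb_pair_unique;
      rewrite comp_assoc; unfold mg_one_times_m, pair_left;
      rewrite ?pb_pair_fst, ?pb_pair_snd, <- comp_assoc, ?pb_pair_fst, ?pb_pair_snd;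
      trivial.
    now rewrite comp_assoc, mg_unit_right, comp_idl, comp_idr.
  + transitivity (mg_m X ∘ (rg_unit_right P X ∘ mg_m X));
      [|now rewrite comp_assoc, mg_unit_right, comp_idl].
    f_equal; apply pb_pair_unique; rewrite !comp_assoc;
      unfold mg_m_times_one, rg_unit_right, pair_left;
      rewrite ?pb_pair_fst, ?pb_pair_snd, <- ?comp_assoc, ?pb_pair_fst, ?pb_pair_snd.
    * now rewrite comp_idl, comp_idr.
    * now rewrite (comp_assoc (pb_snd _)), pb_pair_snd, mg_dm, <- comp_assoc.
(* On triples (1, y, z) both sides are yz: the pairs are (1, yz) and (1y, z) = (y, z). *)
- transitivity (mg_m X); [|symmetry].
  + transitivity (mg_m X ∘ (rg_unit_left P X ∘ mg_m X));
      [|now rewrite comp_assoc, mg_unit_left, comp_idl].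
    f_equal; apply pb_pair_unique; rewrite !comp_assoc;
      unfold mg_one_times_m, rg_unit_left, pair_right;
      rewrite ?pb_pair_fst, ?pb_pair_snd, <- ?comp_assoc, ?pb_pair_fst, ?pb_pair_snd.
    * now rewrite (comp_assoc (pb_fst _)), pb_pair_fst, mg_cm, <- comp_assoc.
    * now rewrite comp_idl, comp_idr.
  + transitivity (mg_m X ∘ idm _); [|apply comp_idr];
      f_equal; apply pb_pair_unique;
      rewrite comp_assoc; unfold mg_m_times_one, pair_right;
      rewrite ?pb_pair_fst, ?pb_pair_snd, <- comp_assoc, ?pb_pair_fst, ?pb_pair_snd;
      trivial.
    now rewrite comp_assoc, mg_unit_left, comp_idl, comp_idr.
Qed.

(** * Left cancellation *)

Lemma m_split_epi : split_epi (mg_m X).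
Proof. exact (split_epi_intro (mg_unit_right X)). Qed.

Lemma mul_cancel_l (hWM : weakly_maltsev P) (hE : has_equalisers C) (T : C)
  (y z z' : hom T (rg_C1 X))
  (h : rg_d X ∘ y = rg_c X ∘ z) (h' : rg_d X ∘ y = rg_c X ∘ z') :
  mul h = mul h' -> z = z'.
Proof.
intro hzz.
(* The kernel pair of multiplication: pairs (y, z), (y', z') with yz = y'z'. The equaliser below
   imposes y = y'. *)
set (K := P m_split_epi m_split_epi).
set (p1 := pb_fst (rg_C2 P X)); set (p2 := pb_snd (rg_C2 P X)).
destruct (hE _ _ (p1 ∘ pb_fst K) (p1 ∘ pb_snd K)) as [E [i [hi uE]]].
(* E consists of the tuples (y, z, z') with yz = yz', as T-points. *)
set (Y := p1 ∘ (pb_fst K ∘ i)).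
set (Z := p2 ∘ (pb_fst K ∘ i)).
set (Z' := p2 ∘ (pb_snd K ∘ i)).
assert (hY' : p1 ∘ (pb_snd K ∘ i) = Y)
  by (unfold Y; now rewrite !comp_assoc).
assert (cZ : rg_d X ∘ Y = rg_c X ∘ Z)
  by (unfold Y, Z, p1, p2; now rewrite !comp_assoc, pb_comm).
assert (cZ' : rg_d X ∘ Y = rg_c X ∘ Z')
  by (rewrite <- hY'; unfold Z', p1, p2; now rewrite !comp_assoc, pb_comm).
assert (hm : mul cZ = mul cZ').
{ rewrite <- (m_eq_mul (w := pb_fst K ∘ i) cZ), <- (m_eq_mul (w := pb_snd K ∘ i) cZ');
    trivial.
  now rewrite !comp_assoc, pb_comm. }
assert (lift : forall (S : C) (a b b' : hom S (rg_C1 X))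
  (k : rg_d X ∘ a = rg_c X ∘ b) (k' : rg_d X ∘ a = rg_c X ∘ b'),
  mul k = mul k' -> exists u : hom S E, Y ∘ u = a /\ Z ∘ u = b /\ Z' ∘ u = b').
{ intros S a b b' k k' hk.
  destruct (uE S (pb_pair K hk)) as [u [hu _]].
  { now rewrite <- !comp_assoc, pb_pair_fst, pb_pair_snd; unfold p1;
      rewrite !pb_pair_fst. }
  exists u; unfold Y, Z, Z'; rewrite <- !comp_assoc, !hu, pb_pair_fst, pb_pair_snd.
  unfold p1, p2; now rewrite pb_pair_fst, !pb_pair_snd. }
(* The section [r] of [Y] sends y to the tuple (y, 1, 1). *)
assert (hr0 : rg_d X ∘ idm _ = rg_c X ∘ (rg_e X ∘ rg_d X))
  by now rewrite c_e, comp_idr.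
destruct (lift _ _ _ _ hr0 hr0 eq_refl) as [r [hr [hrZ hrZ']]].
(* [D] consists of the pairs (y, w) with a common domain, and [s] is its diagonal. Hence [W]
   consists of the tuples (y, z, z', w), over the common component y. *)
set (d_split := split_epi_intro (rg_de X)).
set (D := P d_split d_split).
set (s := pb_pair D (eq_refl (rg_d X ∘ idm (rg_C1 X)))).
assert (hs : pb_fst D ∘ s = idm _) by apply pb_pair_fst.
set (W := P (split_epi_intro hr) (split_epi_intro hs)).
set (w := pb_snd D ∘ pb_snd W).
assert (dw : rg_d X ∘ w = rg_d X ∘ Y ∘ pb_fst W).
{ unfold w; rewrite <- (comp_assoc _ Y), pb_comm, !comp_assoc.
  now rewrite pb_comm. }
assert (cw : rg_d X ∘ w = rg_c X ∘ (Z ∘ pb_fst W))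
  by now rewrite dw, cZ, comp_assoc.
assert (cw' : rg_d X ∘ w = rg_c X ∘ (Z' ∘ pb_fst W))
  by now rewrite dw, cZ', comp_assoc.
assert (hmW : mul cw = mul cw').
(* The two jointly epimorphic maps are (y, z, z') |-> (y, z, z', y), where [hm] applies, and (y, w)
   |-> (y, 1, 1, w), where z and z' coincide. *)
{ apply (hWM _ _ _ _ _ _ _ hr hs); fold W.
  - assert (e1w : w ∘ pair_left hs W = Y).
    { unfold w, pair_left, s.
      now rewrite <- comp_assoc, pb_pair_snd, comp_assoc, pb_pair_snd, comp_idl. }
    assert (e1 : pb_fst W ∘ pair_left hs W = idm _) by apply pb_pair_fst.
    transitivity (mul cZ); [|rewrite hm; symmetry]; apply mul_comp; trivial;
      now rewrite <- comp_assoc, e1, comp_idr.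
  - assert (e2 : pb_fst W ∘ pair_right hr W = r ∘ pb_fst D) by apply pb_pair_fst.
    assert (e2Z : (Z ∘ pb_fst W) ∘ pair_right hr W = (Z' ∘ pb_fst W) ∘ pair_right hr W)
      by now rewrite <- !comp_assoc, e2, !comp_assoc, hrZ, hrZ'.
    assert (k : rg_d X ∘ (w ∘ pair_right hr W)
              = rg_c X ∘ ((Z' ∘ pb_fst W) ∘ pair_right hr W))
      by (rewrite (comp_assoc _ w), cw'; symmetry; apply comp_assoc).
    transitivity (mul k); [|symmetry]; now apply mul_comp. }
destruct (lift _ _ _ _ h h' hzz) as [u [hu [huZ huZ']]].
(* The point [q] of [W] is (y, z, z', 1), with 1 the identity on the domain of y; there wz = wz'
   reads z = z'. *)
assert (hv0 : rg_d X ∘ y = rg_d X ∘ (rg_e X ∘ (rg_d X ∘ y))) by now rewrite d_e.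
set (v := pb_pair D hv0).
assert (huv : Y ∘ u = pb_fst D ∘ v) by (unfold v; now rewrite pb_pair_fst).
set (q := pb_pair W huv).
assert (qw : w ∘ q = rg_e X ∘ (rg_d X ∘ y))
  by (unfold w, q, v; now rewrite <- comp_assoc, !pb_pair_snd).
assert (qZ : (Z ∘ pb_fst W) ∘ q = z)
  by (unfold q; now rewrite <- comp_assoc, pb_pair_fst).
assert (qZ' : (Z' ∘ pb_fst W) ∘ q = z')
  by (unfold q; now rewrite <- comp_assoc, pb_pair_fst).
assert (kz : rg_d X ∘ (rg_e X ∘ (rg_d X ∘ y)) = rg_c X ∘ z) by now rewrite d_e.
assert (kz' : rg_d X ∘ (rg_e X ∘ (rg_d X ∘ y)) = rg_c X ∘ z') by now rewrite d_e.
rewrite <- (mul_e_l kz), <- (mul_e_l kz').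
rewrite <- (mul_comp cw kz qw qZ), <- (mul_comp cw' kz' qw qZ').
now rewrite hmW.
Qed.
End Multiplication.

(** * The preorder of right multiples, and inverses *)

Section RightDivisibility.
Context (C : category) (P : split_pullbacks C) (X : multiplicative_graph P).
Context (hX : is_internal_category X) (hWM : weakly_maltsev P).
Context (hE : has_equalisers C).

(* An edge (y, z) goes from yz to y. *)
Definition div_graph : reflexive_graph C :=
  ReflexiveGraph (mg_unit_right X) (rg_pi1_unit P X).

(** Since y can be cancelled on the left, yz and y determine z. *)
Lemma div_jointly_mono : jointly_mono (rg_d div_graph) (rg_c div_graph).
Proof.
intros T p q hd hc; simpl in *.
apply pb_pair_unique; trivial.
assert (hp : rg_d X ∘ (pb_fst (rg_C2 P X) ∘ q) = rg_c X ∘ (pb_snd (rg_C2 P X) ∘ p))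
  by now rewrite <- hc, !comp_assoc, pb_comm.
assert (hq : rg_d X ∘ (pb_fst (rg_C2 P X) ∘ q) = rg_c X ∘ (pb_snd (rg_C2 P X) ∘ q))
  by now rewrite !comp_assoc, pb_comm.
apply (mul_cancel_l hWM hE (h := hp) (h' := hq)).
now rewrite <- (m_eq_mul hp hc eq_refl), <- (m_eq_mul hq eq_refl eq_refl).
Qed.

(** If y' = yz, then y'z' = y(zz') by associativity, so the edges (y, z) and (y', z') compose to (y,
    zz'). *)
Lemma div_comp_exists : exists m : hom (rg_C2 P div_graph) (rg_C1 div_graph),
  rg_d div_graph ∘ m = rg_d div_graph ∘ pb_snd (rg_C2 P div_graph) /\
  rg_c div_graph ∘ m = rg_c div_graph ∘ pb_fst (rg_C2 P div_graph).
Proof.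
set (Q := rg_C2 P div_graph).
set (p1 := pb_fst (rg_C2 P X)); set (p2 := pb_snd (rg_C2 P X)).
pose proof (pb_comm Q) as hQ; simpl in hQ.
set (y := p1 ∘ pb_fst Q); set (z := p2 ∘ pb_fst Q).
set (y' := p1 ∘ pb_snd Q); set (z' := p2 ∘ pb_snd Q).
assert (hyz : rg_d X ∘ y = rg_c X ∘ z)
  by (unfold y, z, p1, p2; now rewrite !comp_assoc, pb_comm).
assert (hyz' : rg_d X ∘ y' = rg_c X ∘ z')
  by (unfold y', z', p1, p2; now rewrite !comp_assoc, pb_comm).
assert (hy' : mul hyz = y') by (now rewrite <- (m_eq_mul hyz (w := pb_fst Q))).
assert (hzz' : rg_d X ∘ z = rg_c X ∘ z') by now rewrite <- hyz', <- hy', d_mul.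
assert (h1 : rg_d X ∘ y = rg_c X ∘ mul hzz') by now rewrite c_mul.
assert (h2 : rg_d X ∘ mul hyz = rg_c X ∘ z') by now rewrite hy'.
exists (pb_pair (rg_C2 P X) h1); simpl; split.
- change (mul h1 = mg_m X ∘ pb_snd Q).
  rewrite (mul_assoc hX h1 h2), (m_eq_mul (w := pb_snd Q) hyz' eq_refl eq_refl).
  now apply mul_congr.
- apply pb_pair_fst.
Qed.

Lemma has_inverses_of_preorders :
  (forall Y : Cat P, is_internal_preorder Y -> is_equivalence_relation Y) ->
  has_inverses X.
Proof.
intro H.
destruct div_comp_exists as [m [dm cm]].
(* The unit laws need only be checked on endpoints, by [div_jointly_mono]. *)
assert (ur : m ∘ rg_unit_right P div_graph = idm (rg_C1 div_graph)).
{ apply div_jointly_mono; rewrite comp_assoc, ?dm, ?cm, <- comp_assoc, comp_idr;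
    unfold rg_unit_right, pair_left; rewrite ?pb_pair_fst, ?pb_pair_snd.
  - now rewrite comp_assoc, rg_de, comp_idl.
  - apply comp_idr. }
assert (ul : m ∘ rg_unit_left P div_graph = idm (rg_C1 div_graph)).
{ apply div_jointly_mono; rewrite comp_assoc, ?dm, ?cm, <- comp_assoc, comp_idr;
    unfold rg_unit_left, pair_right; rewrite ?pb_pair_fst, ?pb_pair_snd.
  - apply comp_idr.
  - now rewrite comp_assoc, rg_ce, comp_idl. }
set (Y := MultiplicativeGraph ur ul dm cm).
destruct (H (exist _ Y (weakly_maltsev_internal_category Y hWM)) div_jointly_mono)
  as [_ [t [hc [hd _]]]]; simpl in t, hc, hd.
set (p2 := pb_snd (rg_C2 P X)).
(* [i] sends x to (1, x), an edge from x to 1. Its reversal by [t] is an edge (x, w) from 1 to x,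
   that is, xw = 1. *)
set (i := rg_unit_left P X).
set (w := p2 ∘ (t ∘ i)).
assert (f1 : pb_fst (rg_C2 P X) ∘ (t ∘ i) = idm _)
  by (rewrite comp_assoc, hc; apply mg_unit_left).
assert (cw : rg_c X ∘ w = rg_d X).
{ unfold w, p2; rewrite comp_assoc, <- pb_comm, <- comp_assoc, f1.
  apply comp_idr. }
assert (hr : mul (mg_inv_right_comm cw) = rg_e X ∘ rg_c X).
{ rewrite <- (m_eq_mul (w := t ∘ i) (mg_inv_right_comm cw) f1 eq_refl).
  rewrite comp_assoc, hd; apply pb_pair_fst. }
assert (dw : rg_d X ∘ w = rg_c X).
{ rewrite <- (d_mul (mg_inv_right_comm cw)), hr; apply d_e. }
exists w, cw, dw; split; [exact hr|].
change (mul (mg_inv_left_comm dw) = rg_e X ∘ rg_d X).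
(* For the other side, x(wx) = (xw)x = x = x1, and cancelling x gives wx = 1. *)
assert (h1 : rg_d X ∘ idm _ = rg_c X ∘ mul (mg_inv_left_comm dw))
  by now rewrite c_mul, cw, comp_idr.
assert (h2 : rg_d X ∘ mul (mg_inv_right_comm cw) = rg_c X ∘ idm _)
  by now rewrite d_mul, dw, comp_idr.
assert (h3 : rg_d X ∘ idm _ = rg_c X ∘ (rg_e X ∘ rg_d X))
  by now rewrite c_e, comp_idr.
apply (mul_cancel_l hWM hE (h := h1) (h' := h3)).
rewrite mul_e_r, (mul_assoc hX h1 h2).
assert (h4 : rg_d X ∘ (rg_e X ∘ rg_c X) = rg_c X ∘ idm _)
  by now rewrite d_e, comp_idr.
rewrite (mul_congr h2 h4 hr eq_refl); apply mul_e_l.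
Qed.
End RightDivisibility.

Theorem theorem3p1 (C : category) (P : split_pullbacks C)
  (hWM : weakly_maltsev P) (hK : has_kernel_pairs C) (hE : has_equalisers C) :
  is_isomorphism (U2 P) /\
  (is_isomorphism (U3 P) <->
   forall X : Cat P, is_internal_preorder X -> is_equivalence_relation X).
Proof.
split; [|split].
- apply full_inclusion_is_isomorphism.
  intro X; now apply weakly_maltsev_internal_category.
- intros H X hX; split; [exact hX|].
  exact (proj1 (full_inclusion_is_isomorphism _) H X).
- intro H; apply full_inclusion_is_isomorphism; intro X.
  exact (has_inverses_of_preorders (proj2_sig X) hWM hE H).
Qed.
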